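(* Let $0<q<1$. (a) The function $x\mapsto \log\Gamma_q(x)+x\psi_q(x)$ is strictly increasing on $(1,\infty)$ with a single zero, which is in $(1,2)$. (b) The function $x\mapsto\log\Gamma_q(x)-x\psi_q(x)$ is strictly decreasing on $(0,\infty)$ with a single zero, which is in $(1,2)$.
   Context: For $0<q<1$ and complex $a$, $(a;q)_\infty=\prod_{i=0}^{\infty}(1-aq^i)$. For real $x>0$, the $q$-gamma function is $\Gamma_q(x)=\frac{(q;q)_\infty}{(q^x;q)_\infty}(1-q)^{1-x}$, and the $q$-digamma function is $\psi_q(x)=(\log\Gamma_q(x))'=\Gamma_q'(x)/\Gamma_q(x)$. *)

(* Defs.v *)
(* Standard library reals with Coquelicot. *)
From Stdlib Require Import Reals.
From Coquelicot Require Import Coquelicot.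
Open Scope R_scope.

(* (a; q)_oo for real a.  [prod_f_R0 f n] is f 0 * ... * f n; the product
   converges whenever 0 < q < 1, so [real] never meets an infinite limit. *)
Definition qpoch_inf (a q : R) : R :=
  real (Lim_seq (fun n : nat => prod_f_R0 (fun i : nat => 1 - a * q ^ i) n)).

(* Meaningful for 0 < q < 1 and 0 < x, where q^x is [Rpower q x]. *)
Definition qGamma (q x : R) : R :=
  qpoch_inf q q / qpoch_inf (Rpower q x) q * Rpower (1 - q) (1 - x).

Definition qdigamma (q x : R) : R :=
  Derive (fun t : R => ln (qGamma q t)) x.

Definition strictly_increasing_on (D : R -> Prop) (f : R -> R) : Prop :=
  forall x y : R, D x -> D y -> x < y -> f x < f y.

Definition strictly_decreasing_on (D : R -> Prop) (f : R -> R) : Prop :=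
  forall x y : R, D x -> D y -> x < y -> f y < f x.

(* f has exactly one zero in D, and that zero lies in E. *)
Definition single_zero_in (D E : R -> Prop) (f : R -> R) : Prop :=
  exists x0 : R, D x0 /\ E x0 /\ f x0 = 0 /\
    forall x : R, D x -> f x = 0 -> x = x0.

(* Main.v *)
Require Import Defs.
From Stdlib Require Import Reals.
From Coquelicot Require Import Coquelicot.
From Stdlib Require Import Lra.
Open Scope R_scope.

(** Write [G] for [ln (qGamma q x)] and [psi] for its derivative.

    The monotonicity statements use only four facts on [(0, oo)]: [G] is twice
    differentiable, [psi' > 0], [psi'] is nonincreasing, and [G 1 = G 2 = 0].
    For (b), [(G - x psi)' = - x psi' < 0].  For (a), the derivative is
    [2 psi + x psi'], whose sign is not clear where [psi < 0].  But [psi] is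
    concave, so it lies below its tangent at [x]; integrating
    [psi t <= psi x + psi' x (t - x)] over [1 <= t <= 2], where [psi] has
    integral [G 2 - G 1 = 0], gives [psi x >= (x - 3/2) psi' x]
    ([derivative_ge_of_equal_values]).  Hence
    [2 psi x + x psi' x >= 3 (x - 1) psi' x > 0] for [x > 1].
    Since [psi] increases and has mean zero over [[1, 2]], [psi 1 < 0 < psi 2],
    so both functions take values of opposite signs at [1] and [2], and the
    intermediate value theorem places the zero.

    The four facts come from the expansion
    [ln (z; q)_oo = - sum_(n >= 1) z ^ n / (n (1 - q ^ n))]
    ([qpoch_inf_eq_exp]).  In the variable [x], with [z = q ^ x], differentiation
    multiplies the coefficient of index [n] by [n ln q], so [psi'] is
    [(ln q)^2] times a power series in [q ^ x] with nonnegative coefficients: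
    it is positive, and it decreases with [x] because [q ^ x] does. *)

(** * Twice differentiable functions with a positive decreasing second derivative *)

Lemma mean_value (f df : R -> R) (a b : R) :
  a < b -> (forall t, a <= t <= b -> is_derive f t (df t)) ->
  exists c, a < c < b /\ f b - f a = df c * (b - a).
Proof.
  intros Hab Hd.
  destruct (MVT_cor2 f df a b Hab) as [c [Hc1 Hc2]].
  - intros c Hc. apply is_derive_Reals. now apply Hd.
  - now exists c.
Qed.

Lemma increasing_of_derive_pos (f df : R -> R) (m : R) :
  (forall t, m < t -> is_derive f t (df t)) ->
  (forall t, m < t -> 0 < df t) ->
  strictly_increasing_on (fun x => m < x) f.
Proof.
  intros Hd Hpos x y Hx Hy Hxy.
  destruct (mean_value f df x y Hxy) as [c [Hc Heq]].
  - intros t Ht. apply Hd. lra.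
  - assert (0 < df c) by (apply Hpos; lra). nra.
Qed.

Lemma tangent_above (f df : R -> R) (m : R) :
  (forall t, m < t -> is_derive f t (df t)) ->
  (forall s t, m < s -> s < t -> df t <= df s) ->
  forall x t, m < x -> m < t -> f t <= f x + df x * (t - x).
Proof.
  intros Hd Hdec x t Hx Ht.
  destruct (Rtotal_order x t) as [Hlt | [Heq | Hgt]].
  - destruct (mean_value f df x t Hlt) as [c [Hc E]].
    + intros u Hu. apply Hd. lra.
    + assert (df c <= df x) by (apply Hdec; lra). nra.
  - subst t. lra.
  - destruct (mean_value f df t x Hgt) as [c [Hc E]].
    + intros u Hu. apply Hd. lra.
    + assert (df x <= df c) by (apply Hdec; lra). nra.
Qed.

(** The integrated form of [tangent_above]: the mean of [psi] over [[1, 2]] is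
    zero, and the mean of the tangent at [x] is its value at the midpoint. *)
Lemma derivative_ge_of_equal_values (G psi psi1 : R -> R) :
  (forall x, 0 < x -> is_derive G x (psi x)) ->
  (forall x, 0 < x -> is_derive psi x (psi1 x)) ->
  (forall x y, 0 < x -> x < y -> psi1 y <= psi1 x) ->
  G 1 = G 2 ->
  forall x, 0 < x -> (x - 3 / 2) * psi1 x <= psi x.
Proof.
  intros HG Hpsi Hdec H12 x Hx.
  (* [G] minus its second Taylor polynomial at [x], up to a constant; by
     concavity of [psi] it does not increase from [1] to [2]. *)
  destruct (mean_value
    (fun t => G t - psi x * (t - x) - psi1 x * ((t - x) * (t - x)) / 2)
    (fun t => psi t - psi x - psi1 x * (t - x)) 1 2) as [c [Hc E]].
  - lra.
  - intros t Ht.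
    assert (Ht0 : 0 < t) by lra.
    generalize (HG t Ht0); intro Hgt.
    auto_derive.
    + now exists (psi t).
    + replace (Derive _ t) with (psi t); [field |].
      symmetry. now apply is_derive_unique.
  - assert (Ht : psi c <= psi x + psi1 x * (c - x)).
    { apply (tangent_above psi psi1 0); try assumption; lra. }
    cbv beta in E. nra.
Qed.

Lemma derivative_signs_of_equal_values (G psi psi1 : R -> R) :
  (forall x, 0 < x -> is_derive G x (psi x)) ->
  (forall x, 0 < x -> is_derive psi x (psi1 x)) ->
  (forall x, 0 < x -> 0 < psi1 x) ->
  G 1 = G 2 ->
  psi 1 < 0 < psi 2.
Proof.
  intros HG Hpsi Hpos H12.
  destruct (mean_value G psi 1 2) as [c [Hc E]].
  - lra.
  - intros t Ht. apply HG. lra.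
  - assert (Hinc := increasing_of_derive_pos psi psi1 0 Hpsi Hpos).
    assert (psi 1 < psi c) by (apply Hinc; lra).
    assert (psi c < psi 2) by (apply Hinc; lra).
    lra.
Qed.

Lemma single_zero_of_increasing (m : R) (f df : R -> R) :
  m <= 1 ->
  (forall x, 0 < x -> is_derive f x (df x)) ->
  strictly_increasing_on (fun x => m < x) f ->
  f 1 < 0 < f 2 ->
  single_zero_in (fun x => m < x) (fun x => 1 < x < 2) f.
Proof.
  intros Hm Hd Hinc [H1 H2].
  destruct (Ranalysis5.IVT_interv f 1 2) as [z [Hz Hfz]]; try lra.
  - intros a Ha. apply continuity_pt_filterlim.
    apply (ex_derive_continuous f). exists (df a). apply Hd. lra.
  - assert (Hz12 : 1 < z < 2).
    { split; apply Rnot_le_lt; intro Hle.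
      - assert (z = 1) by lra. subst z. lra.
      - assert (z = 2) by lra. subst z. lra. }
    exists z. repeat split; try lra.
    intros x Hx Hfx.
    destruct (Rtotal_order x z) as [Hlt | [Heq | Hgt]]; [| easy |].
    + assert (f x < f z) by (apply Hinc; lra). lra.
    + assert (f z < f x) by (apply Hinc; lra). lra.
Qed.

Lemma single_zero_of_decreasing (m : R) (f df : R -> R) :
  m <= 1 ->
  (forall x, 0 < x -> is_derive f x (df x)) ->
  strictly_decreasing_on (fun x => m < x) f ->
  f 2 < 0 < f 1 ->
  single_zero_in (fun x => m < x) (fun x => 1 < x < 2) f.
Proof.
  intros Hm Hd Hdec H12.
  destruct (single_zero_of_increasing m (fun x => - f x) (fun x => - df x))
    as [z [Dz [Ez [Hz Hu]]]].
  - exact Hm.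
  - intros x Hx. apply (is_derive_opp f). now apply Hd.
  - intros x y Hx Hy Hxy. assert (f y < f x) by now apply Hdec. lra.
  - lra.
  - exists z. repeat split; try easy; try lra.
    intros x Dx Hx. apply Hu; [easy | lra].
Qed.

Lemma monotone_G_plus_minus_x_psi (G psi psi1 : R -> R) :
  (forall x, 0 < x -> is_derive G x (psi x)) ->
  (forall x, 0 < x -> is_derive psi x (psi1 x)) ->
  (forall x, 0 < x -> 0 < psi1 x) ->
  (forall x y, 0 < x -> x < y -> psi1 y <= psi1 x) ->
  G 1 = 0 -> G 2 = 0 ->
  (strictly_increasing_on (fun x => 1 < x) (fun x => G x + x * psi x) /\
   single_zero_in (fun x => 1 < x) (fun x => 1 < x < 2)
     (fun x => G x + x * psi x)) /\
  (strictly_decreasing_on (fun x => 0 < x) (fun x => G x - x * psi x) /\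
   single_zero_in (fun x => 0 < x) (fun x => 1 < x < 2)
     (fun x => G x - x * psi x)).
Proof.
  intros HG Hpsi Hpos Hdec HG1 HG2.
  assert (H12 : G 1 = G 2) by lra.
  destruct (derivative_signs_of_equal_values G psi psi1 HG Hpsi Hpos H12)
    as [Hneg1 Hpos2].
  assert (Hxpsi : forall x, 0 < x ->
            is_derive (fun x => x * psi x) x (psi x + x * psi1 x)).
  { intros x Hx. generalize (Hpsi x Hx); intro Hp.
    replace (psi x + x * psi1 x) with (1 * psi x + x * psi1 x) by ring.
    apply (is_derive_mult (fun t : R => t) psi x 1 (psi1 x)).
    - apply (is_derive_id (K := R_AbsRing)).
    - exact Hp.
    - intros; apply Rmult_comm. }
  assert (Hplus : forall x, 0 < x ->
            is_derive (fun x => G x + x * psi x) x (2 * psi x + x * psi1 x)).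
  { intros x Hx.
    replace (2 * psi x + x * psi1 x) with (psi x + (psi x + x * psi1 x)) by ring.
    apply (is_derive_plus G (fun x => x * psi x)); auto. }
  assert (Hminus : forall x, 0 < x ->
            is_derive (fun x => G x - x * psi x) x (- (x * psi1 x))).
  { intros x Hx.
    replace (- (x * psi1 x)) with (psi x - (psi x + x * psi1 x)) by ring.
    apply (is_derive_minus G (fun x => x * psi x)); auto. }
  assert (Hinc : strictly_increasing_on (fun x => 1 < x)
                   (fun x => G x + x * psi x)).
  { apply (increasing_of_derive_pos _ (fun x => 2 * psi x + x * psi1 x)).
    - intros t Ht. apply Hplus. lra.
    - intros t Ht.
      assert (Ht0 : 0 < t) by lra.
      assert (Hb := derivative_ge_of_equal_values G psi psi1 HG Hpsi Hdec H12
                      t Ht0).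
      assert (Hp := Hpos t Ht0).
      (* The sum is at least [3 (t - 1) psi1 t]. *)
      nra. }
  assert (Hdecr : strictly_decreasing_on (fun x => 0 < x)
                    (fun x => G x - x * psi x)).
  { intros x y Hx Hy Hxy.
    assert (- (G x - x * psi x) < - (G y - y * psi y)); [| lra].
    apply (increasing_of_derive_pos (fun x => - (G x - x * psi x))
             (fun x => x * psi1 x) 0); try assumption.
    - intros t Ht. rewrite <- (Ropp_involutive (t * psi1 t)).
      apply (is_derive_opp (fun x => G x - x * psi x)). now apply Hminus.
    - intros t Ht. apply Rmult_lt_0_compat; [easy | now apply Hpos]. }
  split; split; try assumption.
  - apply (single_zero_of_increasing 1 _ (fun x => 2 * psi x + x * psi1 x));
      try assumption; lra.
  - apply (single_zero_of_decreasing 0 _ (fun x => - (x * psi1 x)));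
      try assumption; lra.
Qed.

(** * Power series on the unit interval *)

(** At a point [r] with [|z| < r < 1] the terms tend to zero, which is
    impossible beyond the disk of convergence; hence [r] is at most the radius. *)
Lemma CV_radius_of_bounded (a : nat -> R) (M z : R) :
  (forall n, Rabs (a n) <= M) -> Rabs z < 1 -> Rbar_lt (Rabs z) (CV_radius a).
Proof.
  intros HM Hz.
  set (r := (Rabs z + 1) / 2).
  assert (Hz0 := Rabs_pos z).
  assert (Hr : Rabs r = r) by (apply Rabs_pos_eq; unfold r; lra).
  apply Rbar_lt_le_trans with (Rabs r).
  { rewrite Hr. simpl. unfold r. lra. }
  apply Rbar_not_lt_le. intro Hlt.
  apply (CV_disk_outside a r Hlt).
  assert (Hgeom : is_lim_seq (fun n => r ^ n) 0).
  { apply is_lim_seq_geom. rewrite Hr. unfold r. lra. }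
  apply is_lim_seq_abs_0.
  apply is_lim_seq_le_le with (u := fun _ => 0) (w := fun n => M * r ^ n).
  - intro n. split; [apply Rabs_pos |].
    rewrite Rabs_mult, <- RPow_abs, Hr.
    apply Rmult_le_compat_r; [| apply HM].
    apply pow_le. unfold r. lra.
  - apply is_lim_seq_const.
  - replace (Finite 0) with (Rbar_mult M 0) by (simpl; f_equal; ring).
    now apply is_lim_seq_scal_l.
Qed.

Lemma PSeries_le (a : nat -> R) (y z : R) :
  (forall n, 0 <= a n) -> Rbar_lt (Rabs z) (CV_radius a) ->
  0 <= y -> y <= z -> PSeries a y <= PSeries a z.
Proof.
  intros Ha Hz Hy Hyz. apply Series_le.
  - intro n. split.
    + apply Rmult_le_pos; [apply Ha | now apply pow_le].
    + apply Rmult_le_compat_l; [apply Ha | now apply pow_incr].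
  - apply ex_series_Rabs. now apply CV_disk_inside.
Qed.

(** The series is at least [a 0 + z * a 1]: the shifted series, having
    nonnegative coefficients, is smallest at the origin. *)
Lemma PSeries_pos (a : nat -> R) (z : R) :
  (forall n, 0 <= a n) -> 0 < a 1%nat ->
  Rbar_lt (Rabs z) (CV_radius a) -> 0 < z -> 0 < PSeries a z.
Proof.
  intros Ha Ha1 Hz Hz0.
  rewrite PSeries_decr_1 by now apply CV_radius_inside.
  assert (Hle : PSeries (PS_decr_1 a) 0 <= PSeries (PS_decr_1 a) z).
  { apply PSeries_le; try lra.
    - intro n. apply Ha.
    - now rewrite CV_radius_decr_1. }
  rewrite PSeries_0 in Hle. unfold PS_decr_1 at 1 in Hle.
  assert (Ha0 := Ha 0%nat). nra.
Qed.

(** The coefficients of [z P'(z)] for [P = PSeries a]; this Euler operator is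
    [d/dx] up to the factor [ln q] in the variable [z = q ^ x]. *)
Definition euler (a : nat -> R) (n : nat) : R := INR n * a n.

Lemma euler_incr_derive (a : nat -> R) (n : nat) :
  euler a n = PS_incr_1 (PS_derive a) n.
Proof.
  destruct n; unfold euler.
  - simpl. rewrite Rmult_0_l. reflexivity.
  - reflexivity.
Qed.

Lemma CV_radius_euler (a : nat -> R) : CV_radius (euler a) = CV_radius a.
Proof.
  rewrite (CV_radius_ext _ _ (euler_incr_derive a)).
  now rewrite CV_radius_incr_1, CV_radius_derive.
Qed.

Lemma ln_neg (q : R) : 0 < q < 1 -> ln q < 0.
Proof. intro Hq. rewrite <- ln_1. apply ln_increasing; lra. Qed.

Lemma Rpower_unit (q x : R) : 0 < q < 1 -> 0 < x -> 0 < Rpower q x < 1.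
Proof.
  intros Hq Hx. split; [apply exp_pos |].
  unfold Rpower. rewrite <- exp_0. apply exp_increasing.
  assert (Hl := ln_neg q Hq). nra.
Qed.

Lemma is_derive_PSeries_Rpower (a : nat -> R) (q x : R) :
  Rbar_lt (Rabs (Rpower q x)) (CV_radius a) ->
  is_derive (fun t => PSeries a (Rpower q t)) x
    (ln q * PSeries (euler a) (Rpower q x)).
Proof.
  intro Hr.
  rewrite (PSeries_ext _ _ _ (euler_incr_derive a)), PSeries_incr_1.
  replace (ln q * (Rpower q x * PSeries (PS_derive a) (Rpower q x)))
    with (ln q * Rpower q x * PSeries (PS_derive a) (Rpower q x)) by ring.
  apply (is_derive_comp (PSeries a) (fun t => Rpower q t)).
  - now apply is_derive_PSeries.
  - unfold Rpower. auto_derive; [easy | ring].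
Qed.

(** * The logarithm of the q-Pochhammer symbol as a power series *)

Definition log_coef (n : nat) : R :=
  match n with O => 0 | S _ => / INR n end.

Lemma log_coef_bounds (n : nat) : 0 <= log_coef n <= 1.
Proof.
  destruct n as [| n]; unfold log_coef; [lra |].
  rewrite S_INR. assert (Hn := pos_INR n). split.
  - apply Rlt_le, Rinv_0_lt_compat. lra.
  - rewrite <- Rinv_1. apply Rinv_le_contravar; lra.
Qed.

Lemma CV_radius_log_coef (z : R) :
  Rabs z < 1 -> Rbar_lt (Rabs z) (CV_radius log_coef).
Proof.
  apply (CV_radius_of_bounded _ 1). intro n.
  assert (H := log_coef_bounds n). rewrite Rabs_pos_eq; lra.
Qed.

Lemma PSeries_log (z : R) : 0 <= z < 1 -> PSeries log_coef z = - ln (1 - z).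
Proof.
  intro Hz.
  destruct (Req_dec z 0) as [-> | Hz0].
  { rewrite PSeries_0, Rminus_0_r, ln_1. simpl. ring. }
  assert (E : PSeries log_coef 0 + ln (1 - 0) = PSeries log_coef z + ln (1 - z)).
  { apply (eq_is_derive (fun t => PSeries log_coef t + ln (1 - t))); [| lra].
    intros t Ht.
    change (is_derive (fun t => PSeries log_coef t + ln (1 - t)) t 0).
    replace 0 with (/ (1 - t) + - / (1 - t)) by ring.
    assert (Habs : Rabs t < 1) by (rewrite Rabs_pos_eq; lra).
    apply (is_derive_plus (PSeries log_coef) (fun t => ln (1 - t))).
    - replace (/ (1 - t)) with (PSeries (PS_derive log_coef) t).
      { apply is_derive_PSeries. now apply CV_radius_log_coef. }
      rewrite <- Series_geom by exact Habs.
      apply Series_ext. intro n. unfold PS_derive, log_coef.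
      field. now apply not_0_INR.
    - auto_derive; [lra | field; lra]. }
  rewrite PSeries_0, Rminus_0_r, ln_1 in E. simpl in E. lra.
Qed.

(** The coefficients of [- ln (z; q)_oo]; for [n = 0] the numerator vanishes,
    so the value is [0] in spite of the zero denominator. *)
Definition lnpoch_coef (q : R) (n : nat) : R := log_coef n / (1 - q ^ n).

Lemma pow_unit (q : R) (n : nat) : 0 < q < 1 -> 0 < q ^ S n <= q.
Proof.
  intro Hq. split; [apply pow_lt; lra |].
  simpl. assert (0 < q ^ n) by (apply pow_lt; lra).
  assert (q ^ n <= 1 ^ n) by (apply pow_incr; lra).
  rewrite pow1 in *. nra.
Qed.

Lemma lnpoch_coef_bounds (q : R) (n : nat) :
  0 < q < 1 -> 0 <= lnpoch_coef q n <= / (1 - q).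
Proof.
  intro Hq. unfold lnpoch_coef, Rdiv.
  assert (Hinv : 0 < / (1 - q)) by (apply Rinv_0_lt_compat; lra).
  destruct n as [| n]; [simpl; lra |].
  assert (Hp := pow_unit q n Hq). assert (Hl := log_coef_bounds (S n)).
  assert (0 < / (1 - q ^ S n)) by (apply Rinv_0_lt_compat; lra).
  assert (/ (1 - q ^ S n) <= / (1 - q)) by (apply Rinv_le_contravar; lra).
  nra.
Qed.

Lemma CV_radius_lnpoch_coef (q z : R) :
  0 < q < 1 -> Rabs z < 1 -> Rbar_lt (Rabs z) (CV_radius (lnpoch_coef q)).
Proof.
  intro Hq. apply (CV_radius_of_bounded _ (/ (1 - q))). intro n.
  assert (H := lnpoch_coef_bounds q n Hq). rewrite Rabs_pos_eq; lra.
Qed.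

(** Replacing [z] by [q z] multiplies the coefficient of index [n] by [q ^ n],
    so the difference cancels the factor [1 - q ^ n] in the denominator and
    leaves the logarithm of the first factor of the product. *)
Lemma PSeries_lnpoch_shift (q z : R) :
  0 < q < 1 -> 0 <= z < 1 ->
  PSeries (lnpoch_coef q) z
    = PSeries (lnpoch_coef q) (z * q) - ln (1 - z).
Proof.
  intros Hq Hz.
  assert (Hr : forall y, 0 <= y < 1 -> ex_pseries (lnpoch_coef q) y).
  { intros y Hy. apply CV_radius_inside, CV_radius_lnpoch_coef; [easy |].
    rewrite Rabs_pos_eq; lra. }
  assert (Hlog := PSeries_log z Hz).
  replace (ln (1 - z)) with (- PSeries log_coef z) by lra.
  unfold Rminus at 1. rewrite Ropp_involutive. unfold PSeries.
  rewrite <- Series_plus.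
  - apply Series_ext. intro n. unfold lnpoch_coef.
    rewrite Rpow_mult_distr.
    destruct n as [| n].
    + simpl. unfold Rdiv. ring.
    + assert (Hp := pow_unit q n Hq).
      field. lra.
  - apply ex_pseries_R. apply Hr. nra.
  - apply ex_pseries_R. apply CV_radius_inside, CV_radius_log_coef.
    rewrite Rabs_pos_eq; lra.
Qed.

Lemma prod_exp_lnpoch (q z : R) (n : nat) :
  0 < q < 1 -> 0 <= z < 1 ->
  prod_f_R0 (fun i => 1 - z * q ^ i) n
    = exp (PSeries (lnpoch_coef q) (z * q ^ S n) - PSeries (lnpoch_coef q) z).
Proof.
  intros Hq Hz. induction n as [| n IH].
  - simpl prod_f_R0. rewrite (PSeries_lnpoch_shift q z Hq Hz), pow_1.
    match goal with |- _ = exp (?a - (?a - ?b)) =>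
      replace (a - (a - b)) with b by ring end.
    rewrite exp_ln; simpl; lra.
  - change (prod_f_R0 (fun i => 1 - z * q ^ i) (S n))
      with (prod_f_R0 (fun i => 1 - z * q ^ i) n * (1 - z * q ^ S n)).
    assert (Hp := pow_unit q n Hq).
    assert (Hy : 0 <= z * q ^ S n < 1) by nra.
    rewrite IH, (PSeries_lnpoch_shift q (z * q ^ S n) Hq Hy).
    replace (z * q ^ S n * q) with (z * q ^ S (S n)) by (simpl; ring).
    rewrite <- (exp_ln (1 - z * q ^ S n)) at 2 by lra.
    rewrite <- exp_plus. f_equal. ring.
Qed.

(** Iterating the shift relation turns the partial products into exponentials;
    the remaining term tends to the value [0] of the series at the origin. *)
Lemma qpoch_inf_eq_exp (q z : R) :
  0 < q < 1 -> 0 <= z < 1 ->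
  qpoch_inf z q = exp (- PSeries (lnpoch_coef q) z).
Proof.
  intros Hq Hz. unfold qpoch_inf.
  rewrite (is_lim_seq_unique _ (exp (- PSeries (lnpoch_coef q) z))); [easy |].
  apply is_lim_seq_ext with (u := fun n =>
    exp (PSeries (lnpoch_coef q) (z * q ^ S n) - PSeries (lnpoch_coef q) z)).
  { intro n. symmetry. now apply prod_exp_lnpoch. }
  set (P := PSeries (lnpoch_coef q)).
  assert (HP : continuity_pt P 0).
  { apply PSeries_continuity, CV_radius_lnpoch_coef; [easy |].
    rewrite Rabs_R0. lra. }
  replace (exp (- P z)) with (exp (P 0 - P z)).
  2: { f_equal. unfold P at 1. rewrite PSeries_0.
       unfold lnpoch_coef. simpl. unfold Rdiv. ring. }
  apply (is_lim_seq_continuous (fun y => exp (P y - P z))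
           (fun n => z * q ^ S n) 0).
  - apply (continuity_pt_comp (fun y => P y - P z) exp).
    + apply continuity_pt_minus; [exact HP |].
      now apply continuity_pt_const.
    + apply derivable_continuous_pt, derivable_pt_exp.
  - replace (Finite 0) with (Rbar_mult z 0) by (simpl; f_equal; ring).
    apply is_lim_seq_scal_l.
    apply (is_lim_seq_incr_1 (fun n => q ^ n)).
    apply is_lim_seq_geom. rewrite Rabs_pos_eq; lra.
Qed.

(** * The q-gamma function *)

Definition ln_qGamma_series (q x : R) : R :=
  PSeries (lnpoch_coef q) (Rpower q x) - PSeries (lnpoch_coef q) q
    + (1 - x) * ln (1 - q).

Definition psi_series (q x : R) : R :=
  ln q * PSeries (euler (lnpoch_coef q)) (Rpower q x) - ln (1 - q).

Definition psi1_series (q x : R) : R :=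
  ln q ^ 2 * PSeries (euler (euler (lnpoch_coef q))) (Rpower q x).

Lemma ln_qGamma_eq (q x : R) :
  0 < q < 1 -> 0 < x -> ln (qGamma q x) = ln_qGamma_series q x.
Proof.
  intros Hq Hx. unfold qGamma, ln_qGamma_series.
  assert (Hu := Rpower_unit q x Hq Hx).
  rewrite !qpoch_inf_eq_exp by lra.
  unfold Rdiv. rewrite <- exp_Ropp. unfold Rpower at 2.
  rewrite <- !exp_plus, ln_exp. ring.
Qed.

Lemma Rabs_Rpower_lt_radius (q x : R) (a : nat -> R) :
  0 < q < 1 -> 0 < x -> CV_radius a = CV_radius (lnpoch_coef q) ->
  Rbar_lt (Rabs (Rpower q x)) (CV_radius a).
Proof.
  intros Hq Hx ->. assert (Hu := Rpower_unit q x Hq Hx).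
  apply CV_radius_lnpoch_coef; [easy |]. rewrite Rabs_pos_eq; lra.
Qed.

Lemma is_derive_ln_qGamma (q x : R) :
  0 < q < 1 -> 0 < x ->
  is_derive (fun t => ln (qGamma q t)) x (psi_series q x).
Proof.
  intros Hq Hx.
  apply is_derive_ext_loc with (f := ln_qGamma_series q).
  { exists (mkposreal x Hx). intros t Ht. symmetry. apply ln_qGamma_eq; [easy |].
    apply Rabs_def2 in Ht. unfold minus, plus, opp in Ht; simpl in Ht. lra. }
  unfold ln_qGamma_series, psi_series.
  apply (is_derive_plus
    (fun t => PSeries (lnpoch_coef q) (Rpower q t) - PSeries (lnpoch_coef q) q)
    (fun t => (1 - t) * ln (1 - q)) x
    (ln q * PSeries (euler (lnpoch_coef q)) (Rpower q x)) (- ln (1 - q))).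
  - rewrite <- (Rminus_0_r (ln q * _)).
    apply (is_derive_minus (fun t => PSeries (lnpoch_coef q) (Rpower q t))
             (fun _ => PSeries (lnpoch_coef q) q)).
    + apply is_derive_PSeries_Rpower. now apply Rabs_Rpower_lt_radius.
    + auto_derive; easy.
  - auto_derive; [easy | ring].
Qed.

Lemma qdigamma_eq (q x : R) :
  0 < q < 1 -> 0 < x -> qdigamma q x = psi_series q x.
Proof. intros Hq Hx. apply is_derive_unique. now apply is_derive_ln_qGamma. Qed.

Lemma is_derive_qdigamma (q x : R) :
  0 < q < 1 -> 0 < x -> is_derive (qdigamma q) x (psi1_series q x).
Proof.
  intros Hq Hx.
  apply is_derive_ext_loc with (f := psi_series q).
  { exists (mkposreal x Hx). intros t Ht. symmetry. apply qdigamma_eq; [easy |].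
    apply Rabs_def2 in Ht. unfold minus, plus, opp in Ht; simpl in Ht. lra. }
  unfold psi_series, psi1_series.
  rewrite <- Rsqr_pow2. unfold Rsqr. rewrite Rmult_assoc.
  rewrite <- (Rminus_0_r (ln q * (ln q * _))).
  apply (is_derive_minus
    (fun t => ln q * PSeries (euler (lnpoch_coef q)) (Rpower q t))
    (fun _ => ln (1 - q))).
  - apply (is_derive_scal
      (fun t => PSeries (euler (lnpoch_coef q)) (Rpower q t))).
    apply is_derive_PSeries_Rpower. apply Rabs_Rpower_lt_radius; try easy.
    apply CV_radius_euler.
  - auto_derive; easy.
Qed.

Lemma euler2_lnpoch_nonneg (q : R) (n : nat) :
  0 < q < 1 -> 0 <= euler (euler (lnpoch_coef q)) n.
Proof.
  intro Hq. unfold euler.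
  assert (Hn := pos_INR n). assert (H := lnpoch_coef_bounds q n Hq).
  apply Rmult_le_pos; [exact Hn |]. apply Rmult_le_pos; [exact Hn | apply H].
Qed.

Lemma CV_radius_euler2 (a : nat -> R) : CV_radius (euler (euler a)) = CV_radius a.
Proof. now rewrite !CV_radius_euler. Qed.

Lemma psi1_series_pos (q x : R) : 0 < q < 1 -> 0 < x -> 0 < psi1_series q x.
Proof.
  intros Hq Hx. unfold psi1_series.
  assert (Hl := ln_neg q Hq).
  assert (Hu := Rpower_unit q x Hq Hx).
  apply Rmult_lt_0_compat; [nra |].
  apply PSeries_pos.
  - intro n. now apply euler2_lnpoch_nonneg.
  - unfold euler, lnpoch_coef. simpl.
    rewrite Rinv_1, !Rmult_1_l, Rmult_1_r. unfold Rdiv. rewrite Rmult_1_l.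
    apply Rinv_0_lt_compat. lra.
  - apply Rabs_Rpower_lt_radius; try easy. apply CV_radius_euler2.
  - apply Hu.
Qed.

Lemma psi1_series_decreasing (q x y : R) :
  0 < q < 1 -> 0 < x -> x < y -> psi1_series q y <= psi1_series q x.
Proof.
  intros Hq Hx Hxy. unfold psi1_series.
  assert (Hl := ln_neg q Hq).
  apply Rmult_le_compat_l; [apply pow2_ge_0 |].
  apply PSeries_le.
  - intro n. now apply euler2_lnpoch_nonneg.
  - apply Rabs_Rpower_lt_radius; try easy. apply CV_radius_euler2.
  - apply Rlt_le, exp_pos.
  - apply Rlt_le, exp_increasing. nra.
Qed.

Lemma ln_qGamma_1 (q : R) : 0 < q < 1 -> ln (qGamma q 1) = 0.
Proof.
  intro Hq. rewrite ln_qGamma_eq by lra. unfold ln_qGamma_series.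
  rewrite Rpower_1 by lra. ring.
Qed.

(** Here [(q; q)_oo = (1 - q) (q ^ 2; q)_oo] is the shift relation at [z = q]. *)
Lemma ln_qGamma_2 (q : R) : 0 < q < 1 -> ln (qGamma q 2) = 0.
Proof.
  intro Hq. rewrite ln_qGamma_eq by lra. unfold ln_qGamma_series.
  replace (Rpower q 2) with (q * q).
  - rewrite (PSeries_lnpoch_shift q q) by lra. ring.
  - replace 2 with (1 + 1) by ring. rewrite Rpower_plus, Rpower_1 by lra. easy.
Qed.

Theorem theorem2 (q : R) (hq0 : 0 < q) (hq1 : q < 1) :
  (strictly_increasing_on (fun x : R => 1 < x)
     (fun x : R => ln (qGamma q x) + x * qdigamma q x) /\
   single_zero_in (fun x : R => 1 < x) (fun x : R => 1 < x < 2)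
     (fun x : R => ln (qGamma q x) + x * qdigamma q x)) /\
  (strictly_decreasing_on (fun x : R => 0 < x)
     (fun x : R => ln (qGamma q x) - x * qdigamma q x) /\
   single_zero_in (fun x : R => 0 < x) (fun x : R => 1 < x < 2)
     (fun x : R => ln (qGamma q x) - x * qdigamma q x)).
Proof.
  assert (Hq : 0 < q < 1) by lra.
  apply (monotone_G_plus_minus_x_psi (fun x => ln (qGamma q x)) (qdigamma q)
           (psi1_series q)).
  - intros x Hx. rewrite qdigamma_eq by easy. now apply is_derive_ln_qGamma.
  - intros x Hx. now apply is_derive_qdigamma.
  - intros x Hx. now apply psi1_series_pos.
  - intros x y Hx Hxy. now apply psi1_series_decreasing.
  - now apply ln_qGamma_1.
  - now apply ln_qGamma_2.
Qed.
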